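(* For a given tricontext $\mathbb{K}=(G,M,B,I)$, $I\subseteq G\times M\times B$, and its associated triset system $\mathcal{T}=\{(X,Y,Z)\in 2^G\times 2^M\times 2^B \mid X\times Y\times Z\subseteq I\}$, the operator $h$ is not monotone with respect to $\sqsubseteq$.
   Context: A formal tricontext $\mathbb{K}=(G,M,B,I)$ consists of sets $G$, $M$, $B$ and a ternary relation $I\subseteq G\times M\times B$. A triset of $\mathbb{K}$ is a triple $(X,Y,Z)$ with $X\subseteq G$, $Y\subseteq M$, $Z\subseteq B$ and $X\times Y\times Z\subseteq I$ (components may be empty). For trisets, $(A_1,B_1,C_1)\sqsubseteq(A_2,B_2,C_2)$ means $A_1\times B_1\times C_1\subseteq A_2\times B_2\times C_2$. Monotone with respect to $\sqsubseteq$ means that $x\sqsubseteq y$ implies $h(x)\sqsubseteq h(y)$ for trisets $x,y\in\mathcal{T}$. The operator $h$ sends a triset $(X,Y,Z)$ of $\mathbb{K}$ to the triple $(U,V,W)$ where $U=\{g\in G\mid \forall m\in Y\ \forall b\in Z:\ (g,m,b)\in I\}$, $V=\{m\in M\mid \forall g\in U\ \forall b\in Z:\ (g,m,b)\in I\}$, $W=\{b\in B\mid \forall g\in U\ \forall m\in V:\ (g,m,b)\in I\}$. *)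

(* Defs.v *)
From mathcomp Require Import all_boot classical_sets.

Set Implicit Arguments.
Unset Strict Implicit.
Unset Printing Implicit Defensive.

Local Open Scope classical_set_scope.

Record tricontext := Tricontext {
  objects : Type;
  attributes : Type;
  conditions : Type;
  incidence : set (objects * attributes * conditions)
}.
Arguments incidence : clear implicits.

Definition triple (K : tricontext) : Type :=
  (set (objects K) * set (attributes K) * set (conditions K))%type.

Definition box (K : tricontext) (x : triple K) :
    set (objects K * attributes K * conditions K) :=
  let: (X, Y, Z) := x in X `*` Y `*` Z.

Definition triset (K : tricontext) (x : triple K) : Prop :=
  box x `<=` incidence K.

(* Only a preorder: all trisets with an empty component are equivalent. *)
Definition trisub (K : tricontext) (x y : triple K) : Prop :=
  box x `<=` box y.

Definition h (K : tricontext) (x : triple K) : triple K :=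
  let: (X, Y, Z) := x in
  let U := [set g | forall m, Y m -> forall b, Z b -> incidence K (g, m, b)] in
  let V := [set m | forall g, U g -> forall b, Z b -> incidence K (g, m, b)] in
  let W := [set b | forall g, U g -> forall m, V m -> incidence K (g, m, b)] in
  (U, V, W).

Lemma h_triset (K : tricontext) (x : triple K) : triset (h x).
Proof. by case: x => [[X Y] Z] [[g m] b] /= [[Ug Vm]] Wb; exact: Wb. Qed.

Definition trisub_monotone (K : tricontext) (f : triple K -> triple K) : Prop :=
  forall x y, triset x -> triset y -> trisub x y -> trisub (f x) (f y).

(* Main.v *)
(* A triset with more conditions forces a smaller first component U. Here the
   context is the 2 x 1 x 2 box with one cell removed, (false, tt, false).
   Growing {true} x {tt} x {true} to {true} x {tt} x {true, false} makes
   h lose the object false, hence the cell (false, tt, true). *)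
Require Import Defs.
From mathcomp Require Import all_boot classical_sets.

Local Open Scope classical_set_scope.

Definition punctured_box : tricontext :=
  @Tricontext bool unit bool [set p | p.1.1 || p.2].

Theorem theorem2 : exists K : tricontext, ~ trisub_monotone (@h K).
Proof.
exists punctured_box => mono.
pose x : triple punctured_box := ([set true], setT, [set true]).
pose y : triple punctured_box := ([set true], setT, setT).
(* Every cell of both boxes has object [true], so [p.1.1 || p.2] holds by its first disjunct. *)
have xT : triset x by move=> [[g m] b] [[/= -> _] _].
have yT : triset y by move=> [[g m] b] [[/= -> _] _].
have xy : trisub x y by move=> [[g m] b] [[/= -> _] _].
(* All three memberships only involve condition [true], where the second disjunct gives incidence
   for every object. *)
have hx : box (h x) (false, tt, true).
  split; first split.
  - by move=> m _ b ->.
  - by move=> g _ b ->; exact: orbT.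
  - by move=> g _ m _; exact: orbT.
have [[Uy _] _] := mono x y xT yT xy _ hx.
(* [Uy] puts object [false] in the first component of [h y]; since [y] has every condition, it
   applies at the removed cell, where incidence is [false || false]. *)
by have := Uy tt I false I.
Qed.
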